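(* Let $(M,g)$ be an asymptotically flat Riemannian manifold of dimension $n\ge3$ with nonempty, compact, smooth boundary $\Sigma=\partial M$. For $A>0$ let $$\mu(A)=\sup_{\overline g\in[g]_h}\{m_{ADM}(\overline g): |\Sigma|_{\overline g}\le A\}.$$ Then the function $\mu:\mathbb{R}^+\to\mathbb{R}$ is independent of the choice of metric in $[g]_h$: if $g'\in[g]_h$, then the function defined by the same formula with $g$ replaced by $g'$ coincides with $\mu$.
   Context: Asymptotically flat (one end): a smooth connected Riemannian manifold $(M,g)$ of dimension $n\ge3$ (possibly with compact boundary) such that there are a compact $K\subset M$ and a diffeomorphism $\Phi:M\setminus K\to\mathbb{R}^n\setminus\overline B$ ($\overline B$ a closed ball) and, in the induced coordinates $(x^i)$, for $|x|$ large, $|g_{ij}-\delta_{ij}|\le c|x|^{-\tau}$, $|\partial_kg_{ij}|\le c|x|^{-\tau-1}$, $|\partial_k\partial_lg_{ij}|\le c|x|^{-\tau-2}$, $|R|\le c|x|^{-q}$, for constants $c>0$, $\tau>\frac{n-2}{2}$, $q>n$, where $R$ is the scalar curvature of $g$. ADM mass: $m_{ADM}(g)=\frac{1}{2(n-1)\omega_{n-1}}\lim_{r\to\infty}\sum_{i,j}\int_{S_r}(\partial_ig_{ij}-\partial_jg_{ii})\frac{x^j}{r}\,dA$, where $S_r=\{|x|=r\}$ and $\omega_{n-1}$ is the area of the unit sphere in $\mathbb{R}^n$. Harmonic conformal class: $[g]_h=\{u^{4/(n-2)}g: u>0 \text{ smooth on } M \text{ (up to the boundary)},\ \Delta_g u=0,\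 u\to1 \text{ at infinity}\}$. Every metric in $[g]_h$ is asymptotically flat. $|\Sigma|_{\overline g}$ is the area (hypersurface measure) of $\Sigma$ with respect to $\overline g$; $\mathbb{R}^+=(0,\infty)$. *)

(* Defs.v *)
(* MathComp, with MathComp-Analysis. *)
From Stdlib Require List.
From HB Require Import structures.
From mathcomp Require Import all_boot all_order all_algebra.
From mathcomp Require Import all_classical all_reals all_analysis.

Set Implicit Arguments.
Unset Strict Implicit.
Unset Printing Implicit Defensive.

Import Order.TTheory GRing.Theory Num.Theory.
Import numFieldNormedType.Exports.
Local Open Scope classical_set_scope.
Local Open Scope ring_scope.

(* Throughout, the dimension of the manifold is n = d.+1, so that its boundary
   has dimension d. Points of R^n are row vectors. The first coordinate (ord0)
   is the one that is nonnegative on the half-space. *)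

Section EuclideanSpace.
Context {R : realType} {d : nat}.
Local Notation E := 'rV[R]_d.+1.

(* The library norm on row vectors is the sup norm. *)
Definition enorm (k : nat) (x : 'rV[R]_k) : R := Num.sqrt (\sum_i x 0 i ^+ 2).

Definition halfspace : set E := [set x | 0 <= x 0 ord0].

Definition partial (i : 'I_d.+1) (f : E -> R) : E -> R :=
  fun x => derive (f : E -> R^o) x (delta_mx 0 i).

Definition ipartial (l : seq 'I_d.+1) (f : E -> R) : E -> R := foldr partial f l.

Definition smooth_open (U : set E) (f : E -> R) : Prop :=
  forall (l : seq 'I_d.+1) (x : E), U x ->
    {for x, continuous (ipartial l f)} /\
    forall i, derivable (ipartial l f : E -> R^o) x (delta_mx 0 i).

(* Smoothness on an arbitrary set is local extendability to smooth functions
   on open sets. On relatively open subsets of the half-space this is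
   smoothness up to the boundary. *)
Definition smooth_on (D : set E) (f : E -> R) : Prop :=
  forall x, D x -> exists U F,
    [/\ open U, U x, smooth_open U F & forall y, (U `&` D) y -> F y = f y].

End EuclideanSpace.

Definition add_coord {R : realType} {k : nat} (t : R) (y : 'rV[R]_k) :
    'rV[R]_k.+1 :=
  row_mx (const_mx t : 'rV[R]_1) y.

(* Lebesgue integral over R^k, as an iterated integral (Tonelli, Fubini). *)
Fixpoint integral_rV {R : realType} (k : nat) : ('rV[R]_k -> \bar R) -> \bar R :=
  match k with
  | 0 => fun f => f 0
  | k'.+1 => fun f => (\int[lebesgue_measure]_t
       integral_rV (fun y : 'rV[R]_k' => f (add_coord t y)))%E
  end.

(* Surface integral over S_r = {|x| = r} in R^(d+1). The open hemispheres
   x_0 > 0 and x_0 < 0 are the graphs of y |-> +s and y |-> -s over |y| < r,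
   with s = sqrt (r^2 - |y|^2) and area element (r / s) dy; the equator is
   negligible. *)
Definition sphere_integral {R : realType} {d : nat} (r : R)
    (f : 'rV[R]_d.+1 -> R) : R :=
  fine (integral_rV (fun y : 'rV[R]_d =>
    if enorm y < r then
      let s := Num.sqrt (r ^+ 2 - enorm y ^+ 2) in
      ((f (add_coord s y) + f (add_coord (- s) y))
         * (r / s))%:E
    else 0%E)).

Definition sphere_area (R : realType) (d : nat) : R :=
  sphere_integral 1 (fun _ : 'rV[R]_d.+1 => 1).

Record chart (R : realType) (d : nat) (M : topologicalType) := Chart {
  cdom : set M;
  cphi : M -> 'rV[R]_d.+1;
  cpsi : 'rV[R]_d.+1 -> M; (* inverse of cphi, arbitrary outside the image *)
  cdom_open : open cdom;
  cphiK : forall p, cdom p -> cpsi (cphi p) = p;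
  cphi_cont : {within cdom, continuous cphi};
  cpsi_cont : {within cphi @` cdom, continuous cpsi};
  cimg_open : exists2 U, open U &
    cphi @` cdom = U \/ cphi @` cdom = U `&` halfspace
}.

Definition cimg (R : realType) (d : nat) (M : topologicalType)
  (c : chart R d M) : set 'rV[R]_d.+1 := cphi c @` cdom c.

Definition smooth_transition (R : realType) (d : nat) (M : topologicalType)
    (c c' : chart R d M) : Prop :=
  forall j, smooth_on (cphi c @` (cdom c `&` cdom c'))
    (fun x => cphi c' (cpsi c x) 0 j).

Definition compatible (R : realType) (d : nat) (M : topologicalType)
    (c c' : chart R d M) : Prop :=
  smooth_transition c c' /\ smooth_transition c' c.

Record manifold (R : realType) (d : nat) := Manifold {
  mpoint :> topologicalType;
  mhausdorff : hausdorff_space mpoint;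
  mcountable : @second_countable mpoint;
  matlas : set (chart R d mpoint);
  mcover : forall p : mpoint, exists2 c, matlas c & cdom c p;
  mcompat : forall c c', matlas c -> matlas c' -> compatible c c';
  mmaximal : forall c, (forall c', matlas c' -> compatible c c') -> matlas c
}.

Section Geometry.
Context {R : realType} {d : nat} (M : manifold R d).
Local Notation E := 'rV[R]_d.+1.
Local Notation n := d.+1.

(* An open subset of R^n consists of interior points only, so a boundary point
   is one that some chart into the half-space sends to {x_0 = 0}. *)
Definition boundary : set M :=
  [set p | exists c, [/\ matlas c, cdom c p & ~ (cimg c)^° (cphi c p)]].

(* The components (g_ij) of a covariant 2-tensor field at a point in a chart;
   only the values for c in the atlas and p in the domain of c matter. *)
Definition tensor2 := chart R d M -> M -> 'M[R]_n.

Definition in_coords (g : tensor2) (c : chart R d M) : E -> 'M[R]_n :=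
  fun x => g c (cpsi c x).

Definition smooth_fun (u : M -> R) : Prop :=
  forall c, matlas c -> smooth_on (cimg c) (u \o cpsi c).

(* With row vectors, 'J f x a b is the a-th partial derivative of the b-th
   component of f. The transformation law on the boundary follows from the one
   in the interior by continuity. *)
Definition riemannian (g : tensor2) : Prop :=
  [/\ forall c, matlas c -> forall i j,
        smooth_on (cimg c) (fun x => in_coords g c x i j),
      forall c p, matlas c -> cdom c p -> (g c p)^T = g c p,
      forall c p, matlas c -> cdom c p -> forall v : E, v != 0 ->
        0 < (v *m g c p *m v^T) 0 0
    & forall c c' p, matlas c -> matlas c' -> cdom c p -> cdom c' p ->
        (cimg c)^° (cphi c p) ->
        let J := 'J (cphi c' \o cpsi c) (cphi c p) in
        g c p = J *m g c' p *m J^T].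

Section Coordinates.
Variable G : E -> 'M[R]_n.

Definition christoffel (k i j : 'I_n) (x : E) : R :=
  2^-1 * \sum_l invmx (G x) k l *
    (partial i (fun y => G y j l) x + partial j (fun y => G y i l) x
     - partial l (fun y => G y i j) x).

Definition ricci (i j : 'I_n) (x : E) : R :=
  \sum_k (partial k (christoffel k i j) x - partial j (christoffel k i k) x
    + \sum_l (christoffel k k l x * christoffel l i j x
              - christoffel k j l x * christoffel l i k x)).

Definition scalar_curvature (x : E) : R :=
  \sum_i \sum_j invmx (G x) i j * ricci i j x.

Definition laplacian (f : E -> R) (x : E) : R :=
  (Num.sqrt (\det (G x)))^-1 * \sum_i \sum_j
    partial i (fun y => Num.sqrt (\det (G y)) * invmx (G y) i j
                        * partial j f y) x.

End Coordinates.

(* On the boundary the equation follows by continuity. *)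
Definition harmonic (g : tensor2) (u : M -> R) : Prop :=
  forall c p, matlas c -> cdom c p -> (cimg c)^° (cphi c p) ->
    laplacian (in_coords g c) (u \o cpsi c) (cphi c p) = 0.

(* Since the atlas is maximal, a diffeomorphism from M \ K to the complement of
   a closed ball is the same as a chart Phi with that domain and image. *)
Definition asymptotically_flat (g : tensor2) (Phi : chart R d M) : Prop :=
  let G := in_coords g Phi in
  [/\ riemannian g,
      matlas Phi,
      exists2 K : set M, compact K & cdom Phi = ~` K,
      exists x0 r0, 0 < r0 /\ cimg Phi = [set x | r0 < enorm (x - x0)]
    & exists c tau q rho : R,
        [/\ 0 < c, (n%:R - 2) / 2 < tau, n%:R < q &
        forall x, rho < enorm x ->
          [/\ forall i j, `|G x i j - (i == j)%:R| <= c * enorm x `^ (- tau),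
              forall i j k, `|partial k (fun y => G y i j) x|
                              <= c * enorm x `^ (- tau - 1),
              forall i j k l, `|partial k (partial l (fun y => G y i j)) x|
                              <= c * enorm x `^ (- tau - 2)
            & `|scalar_curvature G x| <= c * enorm x `^ (- q)]]].

(* The mass is computed in the asymptotic coordinates Phi. *)
Definition adm_mass (Phi : chart R d M) (g : tensor2) : R :=
  let G := in_coords g Phi in
  (2 * (n%:R - 1) * sphere_area R d)^-1 *
  lim ((\sum_i \sum_j sphere_integral r (fun x : E =>
          (partial i (fun y => G y i j) x - partial j (fun y => G y i i) x)
            * (x 0 j / r))) @[r --> +oo]).

Definition tends_to_one (Phi : chart R d M) (u : M -> R) : Prop :=
  forall e : R, 0 < e -> exists rho : R, forall x : E, rho < enorm x ->
    `|u (cpsi Phi x) - 1| < e.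

Definition conformal (u : M -> R) (g : tensor2) : tensor2 :=
  fun c p => (u p `^ (4 / (n%:R - 2))) *: g c p.

Definition harmonic_class (Phi : chart R d M) (g : tensor2) : set tensor2 :=
  [set conformal u g | u in [set u | [/\ smooth_fun u, forall p, 0 < u p,
                                       harmonic g u & tends_to_one Phi u]]].

(* Area of the boundary points that lie in the charts of s but outside D: the
   charts of s are used in turn, each one for the boundary points not covered
   by the previous ones. Dropping the first row and column of g c p gives the
   metric induced on the boundary. *)
Fixpoint area_off (g : tensor2) (D : set M) (s : seq (chart R d M)) : \bar R :=
  if s is c :: s' then
    (integral_rV (fun y : 'rV[R]_d =>
       let x := add_coord 0 y in
       let p := cpsi c x in
       if `[< cimg c x /\ (boundary `\` D) p >]
       then (Num.sqrt (\det (row' ord0 (col' ord0 (g c p)))))%:E else 0)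
     + area_off g (D `|` cdom c) s')%E
  else 0%E.

(* The area computed from a finite cover of the (compact) boundary by charts
   does not depend on the cover; the supremum selects this common value. *)
Definition boundary_area (g : tensor2) : \bar R :=
  ereal_sup [set area_off g set0 s | s in
    [set s | (forall c, List.In c s -> matlas c) /\
             forall p, boundary p -> exists2 c, List.In c s & cdom c p]].

Definition mu (Phi : chart R d M) (g : tensor2) (A : R) : \bar R :=
  ereal_sup [set (adm_mass Phi gbar)%:E | gbar in
    [set gbar | harmonic_class Phi g gbar /\ (boundary_area gbar <= A%:E)%E]].

End Geometry.

Arguments boundary {R d} M _.

(* Main.v *)
Require Import Defs.
From mathcomp Require Import all_boot all_order all_algebra.
From mathcomp Require Import all_classical all_reals all_analysis.
From mathcomp Require Import ring.
Import Order.TTheory GRing.Theory Num.Theory.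
Import numFieldNormedType.Exports.
Local Open Scope classical_set_scope.
Local Open Scope ring_scope.

(* If g' = u^(4/(n-2)) g with u harmonic for g, then
   u Lap_g (u v) = u^(2n/(n-2)) Lap_g' v + u v Lap_g u = u^(2n/(n-2)) Lap_g' v,
   so that v is harmonic for g' exactly when u v is harmonic for g. Hence
   v |-> u v is a bijection between the conformal factors of the harmonic
   classes of g' and of g, with inverse w |-> w / u, and the two classes
   coincide. The supremum defining mu depends on the metric only through its
   class. *)

(** * Calculus of partial derivatives *)

(** Restriction to a line makes the one-variable chain rule available; this serves
    [derivable_sqrt]. *)
Lemma derivable_line (R : realType) (V : normedModType R) (f : V -> R^o)
    (x v : V) :
  derivable f x v <-> derivable (fun t : R^o => f (t *: v + x)) 0 1.
Proof.
rewrite /derivable.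
suff -> : (fun h : R => h^-1 *: ((f \o shift x) (h *: v) - f x)) =
  (fun h : R => h^-1 *: (((fun t : R^o => f (t *: v + x)) \o shift 0) (h *: 1)
     - f (0 *: v + x))) by [].
apply/funext => h /=.
by rewrite /shift /= addr0 scale0r add0r [h *: 1]mulr1.
Qed.

Lemma derivable_sqrt (R : realType) (V : normedModType R) (f : V -> R^o)
    (x v : V) :
  0 < f x -> derivable f x v -> derivable (fun y => Num.sqrt (f y) : R^o) x v.
Proof.
move=> fx0 /derivable_line df; apply/derivable_line.
have fx0' : 0 < f (0 *: v + x) by rewrite scale0r add0r.
have := @is_derive1_comp _ (@Num.sqrt R) (fun t : R => f (t *: v + x)) 0 _ _
  (is_derive1_sqrt fx0') (DeriveDef df erefl).
by case.
Qed.

Section Partial.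
Context {R : realType} {d : nat}.
Local Notation E := 'rV[R]_d.+1.
Implicit Types (f g h : E -> R) (x : E).

Lemma partialM i f g x :
  derivable (f : E -> R^o) x (delta_mx 0 i) ->
  derivable (g : E -> R^o) x (delta_mx 0 i) ->
  partial i (fun y => f y * g y) x = f x * partial i g x + g x * partial i f x.
Proof. exact: deriveM. Qed.

Lemma near_eq_partial i f g x :
  (\forall y \near x, f y = g y) -> partial i f x = partial i g x.
Proof. by move=> fg; apply: near_eq_derive. Qed.

(* Continuity is not implied by the existence of the partial derivatives. *)
Definition C0_derivable_at f x : Prop :=
  {for x, continuous f} /\ forall i, derivable (f : E -> R^o) x (delta_mx 0 i).

Lemma near_eq_C0_derivable_at f g x : (\forall y \near x, f y = g y) ->
  C0_derivable_at f x -> C0_derivable_at g x.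
Proof.
move=> fg [cf df]; split; last by move=> i; apply: near_eq_derivable (df i).
have cf' : f y @[y --> x] --> g x by rewrite -(nbhs_singleton fg).
by apply: cvg_trans cf'; apply: (@near_eq_cvg _ _ (nbhs x) _ f g).
Qed.

Lemma eq_C0_derivable_at f g x : f =1 g ->
  C0_derivable_at f x -> C0_derivable_at g x.
Proof. by move=> /funext ->. Qed.

Lemma C0_derivable_at_cst (c : R) x : C0_derivable_at (fun=> c) x.
Proof.
split=> [|i]; first exact: (@cvg_cst _ c E (nbhs x)).
exact: (derivable_cst (c : R^o)).
Qed.

Lemma C0_derivable_atD f g x : C0_derivable_at f x -> C0_derivable_at g x ->
  C0_derivable_at (fun y => f y + g y) x.
Proof.
move=> [cf df] [cg dg]; split=> [|i]; first exact: continuousD.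
exact: derivableD.
Qed.

Lemma C0_derivable_atM f g x : C0_derivable_at f x -> C0_derivable_at g x ->
  C0_derivable_at (fun y => f y * g y) x.
Proof.
move=> [cf df] [cg dg]; split=> [|i]; first exact: continuousM.
exact: derivableM.
Qed.

Lemma C0_derivable_atV f x : f x != 0 -> C0_derivable_at f x ->
  C0_derivable_at (fun y => (f y)^-1) x.
Proof.
move=> fx [cf df]; split=> [|i]; first exact: continuousV.
exact: derivableV.
Qed.

Lemma C0_derivable_at_sum (I : Type) (r : seq I) (P : pred I)
    (F : I -> E -> R) x :
  (forall i, P i -> C0_derivable_at (F i) x) ->
  C0_derivable_at (fun y => \sum_(i <- r | P i) F i y) x.
Proof.
move=> dF; elim: r => [|i r IH].
  by apply: eq_C0_derivable_at (C0_derivable_at_cst 0 x) => y; rewrite big_nil.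
case Pi: (P i); last first.
  by apply: eq_C0_derivable_at IH => y; rewrite big_cons Pi.
apply: eq_C0_derivable_at (C0_derivable_atD _ _ _ (dF i Pi) IH) => y.
by rewrite big_cons Pi.
Qed.

Lemma C0_derivable_at_prod (I : Type) (r : seq I) (P : pred I)
    (F : I -> E -> R) x :
  (forall i, P i -> C0_derivable_at (F i) x) ->
  C0_derivable_at (fun y => \prod_(i <- r | P i) F i y) x.
Proof.
move=> dF; elim: r => [|i r IH].
  by apply: eq_C0_derivable_at (C0_derivable_at_cst 1 x) => y; rewrite big_nil.
case Pi: (P i); last first.
  by apply: eq_C0_derivable_at IH => y; rewrite big_cons Pi.
apply: eq_C0_derivable_at (C0_derivable_atM _ _ _ (dF i Pi) IH) => y.
by rewrite big_cons Pi.
Qed.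

(** The determinant unfolds to the Leibniz sum over permutations, a polynomial in the entries. *)
Lemma C0_derivable_at_det n (G : E -> 'M[R]_n) x :
  (forall i j, C0_derivable_at (fun y => G y i j) x) ->
  C0_derivable_at (fun y => \det (G y)) x.
Proof.
move=> dG; apply: C0_derivable_at_sum => s _.
apply: C0_derivable_atM; first exact: C0_derivable_at_cst.
exact: C0_derivable_at_prod.
Qed.

(** By continuity the determinant stays nonzero near [x], so Cramer's formula holds there and the
    default value of [invmx] at singular matrices never occurs. *)
Lemma C0_derivable_at_invmx n (G : E -> 'M[R]_n) x i j :
  (forall k l, C0_derivable_at (fun y => G y k l) x) -> \det (G x) != 0 ->
  C0_derivable_at (fun y => invmx (G y) i j) x.
Proof.
move=> dG G0; have dD := C0_derivable_at_det _ _ _ dG.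
apply: (@near_eq_C0_derivable_at
  (fun y => (\det (G y))^-1 * cofactor (G y) j i)).
  apply: filterS (@cvgr_neq0 _ _ _ (nbhs x) _ _ _ dD.1 G0) => y Gy0.
  by rewrite /invmx unitmxE unitfE Gy0 !mxE.
apply: C0_derivable_atM; first exact: C0_derivable_atV.
apply: C0_derivable_atM; first exact: C0_derivable_at_cst.
apply: C0_derivable_at_det => k l.
by under eq_fun do rewrite !mxE; exact: dG.
Qed.

(* The two sides differ by a sum that is antisymmetric in i and j. *)
Lemma sum_partial_weightedM (a : 'I_d.+1 -> 'I_d.+1 -> E -> R) f h x :
  (forall i j, a i j x = a j i x) ->
  (forall i j, C0_derivable_at (a i j) x) ->
  (\forall y \near x, C0_derivable_at f y) ->
  (\forall y \near x, C0_derivable_at h y) ->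
  (forall j, C0_derivable_at (partial j f) x) ->
  (forall j, C0_derivable_at (partial j h) x) ->
  f x * (\sum_i \sum_j partial i
           (fun y => a i j y * partial j (fun z => f z * h z) y) x) =
  \sum_i \sum_j partial i (fun y => f y * f y * a i j y * partial j h y) x +
  f x * h x * (\sum_i \sum_j partial i (fun y => a i j y * partial j f y) x).
Proof.
move=> sa da df dh ddf ddh.
have [_ dfx] := nbhs_singleton df; have [_ dhx] := nbhs_singleton dh.
(* The product rule, term by term; the last summand is the cross term that is antisymmetric once
   summed with a symmetric [a]. *)
have termE i j : f x * partial i
           (fun y => a i j y * partial j (fun z => f z * h z) y) x =
   partial i (fun y => f y * f y * a i j y * partial j h y) x +
   f x * h x * partial i (fun y => a i j y * partial j f y) x +
   f x * (a i j x * partial i h x * partial j f x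
          - a i j x * partial i f x * partial j h x).
  have dfc := nbhs_singleton df; have dhc := nbhs_singleton dh.
  (* The inner derivative is itself differentiated, so the product rule is needed at all points near
     [x]. *)
  have -> : partial i (fun y => a i j y * partial j (fun z => f z * h z) y) x =
    partial i
      (fun y => a i j y * (f y * partial j h y + h y * partial j f y)) x.
    apply: near_eq_partial; apply: filterS2 df dh => y [_ dfy] [_ dhy].
    by congr (_ * _); exact: partialM.
  have d1 := C0_derivable_atM _ _ _ dfc (ddh j).
  have d2 := C0_derivable_atM _ _ _ dhc (ddf j).
  have d3 := C0_derivable_atD _ _ _ d1 d2.
  have d4 := C0_derivable_atM _ _ _ dfc dfc.
  have d5 := C0_derivable_atM _ _ _ d4 (da i j).
  rewrite (partialM _ _ _ _ ((da i j).2 i) (d3.2 i)).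
  have -> : partial i (fun y => f y * partial j h y + h y * partial j f y) x =
    partial i (fun y => f y * partial j h y) x +
    partial i (fun y => h y * partial j f y) x.
    exact: (@deriveD _ _ _ _ _ _ _ (d1.2 i) (d2.2 i)).
  rewrite (partialM _ _ _ _ (dfx i) ((ddh j).2 i)).
  rewrite (partialM _ _ _ _ (dhx i) ((ddf j).2 i)).
  rewrite (partialM _ _ _ _ (d5.2 i) ((ddh j).2 i)).
  rewrite (partialM _ _ _ _ (d4.2 i) ((da i j).2 i)).
  rewrite (partialM _ _ _ _ (dfx i) (dfx i)).
  rewrite (partialM _ _ _ _ ((da i j).2 i) ((ddf j).2 i)).
  move: (f x) (h x) (a i j x) (partial i f x) (partial i h x) (partial j f x)
    (partial j h x) (partial i (partial j f) x) (partial i (partial j h) x)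
    (partial i (a i j) x)
    => {dfc dhc sa da df dh ddf ddh dfx dhx d1 d2 d3 d4 d5}.
  move=> ? ? ? ? ? ? ? ? ? ?; ring.
rewrite mulr_sumr; under eq_bigr do rewrite mulr_sumr.
under eq_bigr do under eq_bigr do rewrite termE.
under eq_bigr do rewrite !big_split /=.
(* The cross terms cancel: exchanging the two sums and using [sa] turns one half into the other. *)
rewrite !big_split /= [X in _ + X](_ : _ = 0) ?addr0; last first.
  under eq_bigr do rewrite -mulr_sumr sumrB.
  rewrite -mulr_sumr sumrB [X in _ - X]exchange_big /= (_ : _ - _ = 0) ?mulr0//.
  apply/eqP; rewrite subr_eq0; apply/eqP.
  apply: eq_bigr => i _; apply: eq_bigr => j _.
  by rewrite sa mulrAC.
congr (_ + _).
by rewrite mulr_sumr; apply: eq_bigr => i _; rewrite mulr_sumr.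
Qed.

End Partial.

(** * Conformal change of the Laplacian *)

(* With t = u^(2/(n-2)), the left-hand side scales as t^n / t^2 = u^2. *)
Lemma conformal_weight (R : realType) (d : nat) (A : 'M[R]_d.+1) (u : R) i j :
  (2 <= d)%N -> 0 < u -> 0 < \det A ->
  let B := (u `^ (4 / (d.+1%:R - 2))) *: A in
  Num.sqrt (\det B) * invmx B i j = u * u * (Num.sqrt (\det A) * invmx A i j).
Proof.
move=> d2 u0 A0 B; pose t := u `^ (2 / (d.+1%:R - 2)).
have t0 : 0 < t by exact: powR_gt0.
have BE : B = (t ^+ 2) *: A.
  by rewrite /B -powR_mulrn ?ltW// /t -powRrM; congr (_ `^ _ *: _); ring.
(* Here [d.-1] is n - 2, the denominator in the exponent of t. *)
have tu : t ^+ d.-1 = u ^+ 2.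
  rewrite -!powR_mulrn ?ltW// /t -powRrM; congr (_ `^ _).
  have -> : d.+1%:R - 2 = d.-1%:R :> R.
    by apply/eqP; rewrite subr_eq -natrD addn2; case: (d) d2.
  by rewrite divfK// pnatr_eq0; case: (d) d2 => [|[]].
have tn : t != 0 by rewrite gt_eqF.
rewrite BE detZ -exprM mulnC exprM sqrtrM ?sqr_ge0// sqrtr_sqr.
rewrite ger0_norm ?exprn_ge0 ?ltW//.
rewrite invmxZ ?unitmxZ ?unitfE ?expf_neq0 ?unitmxE ?unitfE ?gt_eqF// mxE.
(* Since n = 2 + (n - 2), the factor t^2 splits off and cancels the t^(-2) coming from the inverse
   matrix. *)
have -> : t ^+ d.+1 = t ^+ 2 * u ^+ 2.
  by rewrite -tu -exprD; congr (_ ^+ _); case: (d) d2.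
field; exact: tn.
Qed.

Section LaplacianConformal.
Context {R : realType} {d : nat}.
Local Notation E := 'rV[R]_d.+1.

(** Divide [sum_partial_weightedM], taken with a = sqrt(det G) G^(-1), by sqrt(det G). The factor
    [k] is existential because only its nonvanishing matters later and its value differs when the
    determinant is not positive. *)
Lemma laplacian_conformal (G G' : E -> 'M[R]_d.+1) (f h : E -> R) (x : E) :
  (2 <= d)%N ->
  (forall i j, C0_derivable_at (fun y => G y i j) x) ->
  (G x)^T = G x ->
  (\forall y \near x, 0 < f y /\ G' y = (f y `^ (4 / (d.+1%:R - 2))) *: G y) ->
  (\forall y \near x, C0_derivable_at f y) ->
  (\forall y \near x, C0_derivable_at h y) ->
  (forall j, C0_derivable_at (partial j f) x) ->
  (forall j, C0_derivable_at (partial j h) x) ->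
  exists2 k, k != 0 & f x * laplacian G (fun y => f y * h y) x =
    k * laplacian G' h x + f x * h x * laplacian G f x.
Proof.
move=> d2 dG sG GG' df dh ddf ddh.
have [fx0 G'x] := nbhs_singleton GG'.
have c0 : 0 < f x `^ (4 / (d.+1%:R - 2)) by exact: powR_gt0.
have dD := C0_derivable_at_det _ _ _ dG.
(* Junk values: sqrt vanishes on nonpositive numbers and 0^-1 = 0. *)
have [D0|D0] := leP (\det (G x)) 0.
  exists 1; first exact: oner_neq0.
  have D'0 : \det (G' x) <= 0 by rewrite G'x detZ pmulr_rle0 ?exprn_gt0.
  have L0 (N : E -> 'M[R]_d.+1) k : \det (N x) <= 0 -> laplacian N k x = 0.
    by move=> N0; rewrite /laplacian (ler0_sqrtr N0) invr0; exact: mul0r.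
  rewrite (L0 _ _ D0) (L0 _ _ D'0) (L0 _ _ D0).
  by rewrite (mulr0 (f x)) (mulr0 1) (mulr0 (f x * h x)) addr0.
have D'0 : 0 < \det (G' x) by rewrite G'x detZ mulr_gt0 ?exprn_gt0.
pose a i j y := Num.sqrt (\det (G y)) * invmx (G y) i j.
have dS : C0_derivable_at (fun y => Num.sqrt (\det (G y))) x.
  split=> [|i]; last exact: derivable_sqrt (dD.2 i).
  exact: (continuous_comp dD.1 (@sqrt_continuous R _)).
have da i j : C0_derivable_at (a i j) x.
  exact: (C0_derivable_atM _ _ _ dS
    (C0_derivable_at_invmx _ _ _ _ _ dG (lt0r_neq0 D0))).
have sa i j : a i j x = a j i x.
  by congr (_ * _); rewrite -[in RHS]sG -trmx_inv mxE.
(* The ratio of the volume densities, which equals f^(2n/(n-2)) at [x]. *)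
exists (Num.sqrt (\det (G' x)) / Num.sqrt (\det (G x))).
  by rewrite mulf_neq0 ?invr_eq0// sqrtr_eq0 -ltNge.
have L'E : laplacian G' h x = (Num.sqrt (\det (G' x)))^-1 *
    \sum_i \sum_j partial i (fun y => f y * f y * a i j y * partial j h y) x.
  congr (_ * _).
  apply: eq_bigr => i _; apply: eq_bigr => j _; apply: near_eq_partial.
  (* The weights stand under a derivative, so [conformal_weight] must apply on a neighbourhood of
     [x]. *)
  have Dnear : \forall y \near x, 0 < \det (G y).
    exact: (@cvgr_gt _ _ (nbhs x) _ _ _ dD.1 _ D0).
  apply: filterS2 GG' Dnear => y [fy0 ->] Dy0.
  by rewrite conformal_weight.
have key := sum_partial_weightedM _ _ _ _ sa da df dh ddf ddh.
have alg (s s' S S' T p q : R) : s != 0 -> s' != 0 -> p * S = S' + p * q * T ->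
    p * (s^-1 * S) = s' / s * (s'^-1 * S') + p * q * (s^-1 * T).
  move=> s0 s'0 e; rewrite mulrCA e.
  by field; apply/andP.
have sn : Num.sqrt (\det (G x)) != 0 by rewrite sqrtr_eq0 -ltNge.
have sn' : Num.sqrt (\det (G' x)) != 0 by rewrite sqrtr_eq0 -ltNge.
rewrite L'E; exact: (alg _ _ _ _ _ _ _ sn sn' key).
Qed.

End LaplacianConformal.

(** * Products and inverses of smooth functions *)

Section Smooth.
Context {R : realType} {d : nat}.
Local Notation E := 'rV[R]_d.+1.
Implicit Types (f g h : E -> R) (x : E) (U D : set E).

(** Smoothness graded by order: the derivative of a product is a sum of products, so closure
    properties go by induction on the order rather than on a list of indices. *)
Fixpoint Ck (k : nat) U f : Prop :=
  (forall x, U x -> C0_derivable_at f x) /\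
  (if k is k'.+1 then forall i, Ck k' U (partial i f) else True).

Lemma Ck_C0 k U f : Ck k U f -> forall x, U x -> C0_derivable_at f x.
Proof. by case: k => [|k] []. Qed.

Lemma smooth_openP U f : smooth_open U f <-> forall k, Ck k U f.
Proof.
split=> [sf k|Cf l].
  elim: k f sf => [|k IH] f sf; split=> //; try exact: (sf [::]).
  (* [foldr] applies the last index of the list first, whereas [Ck] peels off the first derivative
     taken; hence [rcons]. *)
  move=> i; apply: IH => l; have := sf (rcons l i).
  by rewrite /ipartial foldr_rcons.
elim/last_ind: l f Cf => [|l i IH] f Cf; first exact: Ck_C0 (Cf 0%N).
rewrite /ipartial foldr_rcons; apply: IH => k.
by have [_ /(_ i)] := Cf k.+1.
Qed.

Lemma Ck_leS k U f : Ck k.+1 U f -> Ck k U f.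
Proof.
elim: k f => [|k IH] f [c1 c2]; split=> //.
by move=> i; exact: IH (c2 i).
Qed.

(** On an open set, equality on [U] is equality near each of its points, which partial derivatives
    respect. *)
Lemma eq_Ck k U f g : open U -> (forall x, U x -> f x = g x) ->
  Ck k U f -> Ck k U g.
Proof.
move=> oU; have nfg f' g' : (forall x, U x -> f' x = g' x) ->
    forall x, U x -> \forall y \near x, f' y = g' y.
  by move=> fg x Ux; apply: filterS fg _; exact: open_nbhs_nbhs.
elim: k f g => [|k IH] f g fg [c1 c2].
  split; last exact: I.
  by move=> x Ux; exact: near_eq_C0_derivable_at (nfg _ _ fg x Ux) (c1 x Ux).
split=> [x Ux|i].
  exact: near_eq_C0_derivable_at (nfg _ _ fg x Ux) (c1 x Ux).
by apply: IH (c2 i) => x Ux; exact: near_eq_partial (nfg _ _ fg x Ux).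
Qed.

Lemma Ck_cst k U c : Ck k U (fun=> c).
Proof.
elim: k c => [|k IH] c; split=> //; try by move=> *; exact: C0_derivable_at_cst.
move=> i; have -> : partial i (fun=> c) = (fun=> 0) :> (E -> R); last exact: IH.
by apply/funext => x; exact: (derive_cst (c : R^o)).
Qed.

Lemma CkD k U f g : open U -> Ck k U f -> Ck k U g ->
  Ck k U (fun y => f y + g y).
Proof.
move=> oU; elim: k f g => [|k IH] f g [cf df] [cg dg].
  by split; [move=> x Ux; exact: C0_derivable_atD (cf x Ux) (cg x Ux)|].
split=> [x Ux|i]; first exact: C0_derivable_atD (cf x Ux) (cg x Ux).
apply: (eq_Ck _ _ _ _ oU _ (IH _ _ (df i) (dg i))) => x Ux.
by symmetry; exact: (deriveD ((cf x Ux).2 i) ((cg x Ux).2 i)).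
Qed.

Lemma CkM k U f g : open U -> Ck k U f -> Ck k U g ->
  Ck k U (fun y => f y * g y).
Proof.
move=> oU; elim: k f g => [|k IH] f g Cf Cg.
  by split=> // x Ux; exact: C0_derivable_atM (Cf.1 x Ux) (Cg.1 x Ux).
have [[cf df] [cg dg]] := (Cf, Cg).
split=> [x Ux|i]; first exact: C0_derivable_atM (cf x Ux) (cg x Ux).
(* The Leibniz rule pairs a function of order k+1 with a derivative of order k; [Ck_leS] lowers the
   former to order k. *)
apply: (eq_Ck _ _ _ _ oU _ (CkD _ _ _ _ oU
  (IH _ _ (Ck_leS _ _ _ Cf) (dg i)) (IH _ _ (Ck_leS _ _ _ Cg) (df i)))) => x Ux.
by rewrite (partialM _ _ _ _ ((cf x Ux).2 i) ((cg x Ux).2 i)).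
Qed.

Lemma CkV k U f : open U -> (forall x, U x -> f x != 0) ->
  Ck k U f -> Ck k U (fun y => (f y)^-1).
Proof.
move=> oU f0; elim: k => [|k IH] Cf.
  by split=> // x Ux; exact: C0_derivable_atV (f0 x Ux) (Cf.1 x Ux).
have [cf df] := Cf.
split=> [x Ux|i]; first exact: C0_derivable_atV (f0 x Ux) (cf x Ux).
have CV := IH (Ck_leS _ _ _ Cf).
(* The derivative of 1/f is -1 (1/f)(1/f) f', where 1/f has order k by induction. *)
apply: (eq_Ck _ _ _ _ oU _ (CkM _ _ _ _ oU (CkM _ _ _ _ oU (Ck_cst k U (-1))
  (CkM _ _ _ _ oU CV CV)) (df i))) => x Ux.
rewrite /partial (deriveV (f0 x Ux) ((cf x Ux).2 i)).
by rewrite mulN1r -expr2 exprVn.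
Qed.

Lemma smooth_openM U f g : open U ->
  smooth_open U f -> smooth_open U g -> smooth_open U (fun y => f y * g y).
Proof.
move=> oU /smooth_openP Cf /smooth_openP Cg; apply/smooth_openP => k.
exact: CkM.
Qed.

Lemma smooth_openV U f : open U -> (forall x, U x -> f x != 0) ->
  smooth_open U f -> smooth_open U (fun y => (f y)^-1).
Proof.
move=> oU f0 /smooth_openP Cf; apply/smooth_openP => k; exact: CkV.
Qed.

Lemma smooth_openS U V f : U `<=` V -> smooth_open V f -> smooth_open U f.
Proof. by move=> UV sf l x /UV; exact: sf. Qed.

Lemma smooth_onM D f g :
  smooth_on D f -> smooth_on D g -> smooth_on D (fun y => f y * g y).
Proof.
move=> sf sg x Dx.
have [U [F [oU Ux sF Ff]]] := sf x Dx; have [V [G [oV Vx sG Gg]]] := sg x Dx.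
exists (U `&` V), (fun y => F y * G y); split=> //; first exact: openI.
  apply: smooth_openM; first exact: openI.
    exact: smooth_openS sF.
  exact: smooth_openS sG.
by move=> y [[Uy Vy] Dy]; rewrite Ff ?Gg.
Qed.

Lemma smooth_onV D f : (forall x, D x -> f x != 0) ->
  smooth_on D f -> smooth_on D (fun y => (f y)^-1).
Proof.
move=> f0 sf x Dx; have [U [F [oU Ux sF Ff]]] := sf x Dx.
have Fx0 : F x != 0 by rewrite Ff ?f0.
(* The extension [F] may vanish off [D], so [U] is shrunk to an open set where it does not. *)
exists (U `&` [set y | F y != 0])^°, (fun y => (F y)^-1).
have sub := @interior_subset E (U `&` [set y | F y != 0]).
split; first exact: open_interior.
- apply: filterI; first exact: open_nbhs_nbhs.
  exact: (@cvgr_neq0 _ _ _ (nbhs x) _ _ _ (sF [::] x Ux).1 Fx0).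
- apply: smooth_openV; first exact: open_interior.
    by move=> y /sub[].
  by apply: smooth_openS sF => y /sub[].
by move=> y [/sub[Uy _] Dy]; rewrite Ff.
Qed.

(** Near an interior point the local extension agrees with [f], so its two-sided derivatives are
    those of [f]. Order 1 in [Ck] already gives the second derivatives that the Laplacian
    involves. *)
Lemma smooth_on_interior D f x : smooth_on D f -> D^° x ->
  (\forall y \near x, C0_derivable_at f y) /\
  forall i, C0_derivable_at (partial i f) x.
Proof.
move=> sf Dx; have [U [F [oU Ux sF Ff]]] := sf x (interior_subset Dx).
have oV : open (U `&` D^°) by apply: openI => //; exact: open_interior.
have Ff' y : (U `&` D^°) y -> F y = f y.
  by move=> [Uy /interior_subset Dy]; exact: Ff.
have /smooth_openP CF : smooth_open (U `&` D^°) F by apply: smooth_openS sF.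
have [Cf Df] := eq_Ck 1 _ _ _ oV Ff' (CF 1%N).
have Vx : (U `&` D^°) x by [].
split=> [|i]; last exact: (Df i).1.
by apply: filterS Cf _; exact: open_nbhs_nbhs.
Qed.

End Smooth.

(** * Limits at infinity *)

Section AtInfinity.
Context {R : realType} {d : nat} (M : manifold R d) (Phi : chart R d M).
Implicit Types u v : M -> R.

(** Phrasing [tends_to_one] as convergence along this filter gives access to the limit rules for
    products and inverses. *)
Definition at_infinity : set_system 'rV[R]_d.+1 :=
  filter_from [set: R] (fun rho => [set x | rho < enorm x]).

#[local] Instance at_infinity_filter : Filter at_infinity.
Proof.
apply: filter_from_filter; first by exists 0.
move=> a b _ _; exists (Num.max a b) => // x /=.
by rewrite gt_max => /andP.
Qed.

Lemma tends_to_oneP u :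
  tends_to_one Phi u <-> u (cpsi Phi x) @[x --> at_infinity] --> (1 : R).
Proof.
split=> [u1|/cvgrPdist_lt u1 e /u1[rho _ H]].
  apply/cvgrPdist_lt => e /u1[rho H]; exists rho => // x /H.
  by rewrite distrC.
by exists rho => x /H; rewrite distrC.
Qed.

Lemma tends_to_oneM u v : tends_to_one Phi u -> tends_to_one Phi v ->
  tends_to_one Phi (fun p => u p * v p).
Proof.
move=> /tends_to_oneP u1 /tends_to_oneP v1; apply/tends_to_oneP.
by have H := cvgM u1 v1; rewrite mulr1 in H; exact: H.
Qed.

Lemma tends_to_oneV u : tends_to_one Phi u ->
  tends_to_one Phi (fun p => (u p)^-1).
Proof.
move=> /tends_to_oneP u1; apply/tends_to_oneP.
by have H := cvgV (oner_neq0 R) u1; rewrite invr1 in H; exact: H.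
Qed.

End AtInfinity.

(** * Equality of harmonic conformal classes *)

Section HarmonicClass.
Context {R : realType} {d : nat} (M : manifold R d).
Implicit Types (g : tensor2 M) (u v w : M -> R).

Lemma smooth_funM u v : smooth_fun u -> smooth_fun v ->
  smooth_fun (fun p => u p * v p).
Proof. by move=> su sv c cM; exact: smooth_onM (su c cM) (sv c cM). Qed.

Lemma smooth_funV u : (forall p, u p != 0) -> smooth_fun u ->
  smooth_fun (fun p => (u p)^-1).
Proof. by move=> u0 su c cM; apply: smooth_onV (su c cM) => x _; exact: u0. Qed.

Lemma conformal_conformal g u v : (forall p, 0 < u p) -> (forall p, 0 < v p) ->
  conformal v (conformal u g) = conformal (fun p => u p * v p) g.
Proof.
move=> u0 v0; apply/funext => c; apply/funext => p.
by rewrite /conformal scalerA -powRM ?ltW// mulrC.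
Qed.

Lemma harmonic_conformal g u v : (2 <= d)%N -> riemannian g ->
  smooth_fun u -> (forall p, 0 < u p) -> Defs.harmonic g u -> smooth_fun v ->
  Defs.harmonic (conformal u g) v <-> Defs.harmonic g (fun p => u p * v p).
Proof.
move=> d2 [sg symg _ _] su u0 hu sv.
(* Harmonicity of [u] removes the last term of [laplacian_conformal]; as [u p] and [k] are nonzero,
   either Laplacian vanishes exactly when the other does. *)
suff key c p : matlas c -> cdom c p -> (cimg c)^° (cphi c p) ->
    exists2 k, k != 0 &
      u p * laplacian (in_coords g c)
        ((fun q => u q * v q) \o cpsi c) (cphi c p) =
      k * laplacian (in_coords (conformal u g) c) (v \o cpsi c) (cphi c p).
  split=> H c p cM cp ip; have [k k0 e] := key c p cM cp ip.
    move/eqP: e; rewrite H// mulr0 mulf_eq0 => /orP[/eqP up|/eqP//].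
    by have := u0 p; rewrite up ltxx.
  move/eqP: e; rewrite H// mulr0 eq_sym mulf_eq0 => /orP[/eqP kp|/eqP//].
  by rewrite kp eqxx in k0.
move=> cM cp ip.
have [uC uD] := smooth_on_interior _ _ _ (su c cM) ip.
have [vC vD] := smooth_on_interior _ _ _ (sv c cM) ip.
have gC i j : C0_derivable_at (fun y => in_coords g c y i j) (cphi c p).
  have [gC _] := smooth_on_interior _ _ _ (sg c cM i j) ip.
  exact: nbhs_singleton gC.
have gT : (in_coords g c (cphi c p))^T = in_coords g c (cphi c p).
  by rewrite /in_coords cphiK// symg.
have uG : \forall y \near cphi c p, 0 < u (cpsi c y) /\
    in_coords (conformal u g) c y =
    (u (cpsi c y) `^ (4 / (d.+1%:R - 2))) *: in_coords g c y.
  by apply: filterE => y; split=> //; exact: u0.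
have [k k0 e] := laplacian_conformal _ _ _ _ _ d2 gC gT uG uC vC uD vD.
have cancel (a b w s : R) : s = 0 -> a = b + w * s -> a = b.
  by move=> -> ->; rewrite mulr0 addr0.
exists k; first exact: k0.
(* The identity in coordinates has [u] at [cpsi c (cphi c p)], which is [p] by [cphiK]. *)
apply: etrans (cancel _ _ _ _ (hu c p cM cp ip) e).
by congr (u _ * _); symmetry; exact: cphiK.
Qed.

Lemma harmonic_class_conformal g u (Phi : chart R d M) : (2 <= d)%N ->
  riemannian g -> smooth_fun u -> (forall p, 0 < u p) -> Defs.harmonic g u ->
  tends_to_one Phi u ->
  harmonic_class Phi (conformal u g) = harmonic_class Phi g.
Proof.
move=> d2 rg su u0 hu u1; apply/seteqP; split=> _ [v [sv v0 hv v1] <-].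
  exists (fun p => u p * v p); last by rewrite conformal_conformal.
  split; first exact: smooth_funM.
  - by move=> p; exact: mulr_gt0.
  - exact: (proj1 (harmonic_conformal _ _ _ d2 rg su u0 hu sv) hv).
  - exact: tends_to_oneM.
(* Reverse inclusion: [w] is the factor leading from [conformal u g] to [conformal v g]. *)
pose w p := (u p)^-1 * v p.
have un0 p : u p != 0 by rewrite gt_eqF.
have w0 p : 0 < w p by rewrite mulr_gt0 ?invr_gt0.
have uw : (fun p => u p * w p) = v.
  by apply/funext => p; rewrite /w mulVKf.
have sw : smooth_fun w by apply: smooth_funM => //; exact: smooth_funV.
exists w; last by rewrite conformal_conformal// uw.
split; [exact: sw|exact: w0| |].
  by apply: (proj2 (harmonic_conformal _ _ _ d2 rg su u0 hu sw)); rewrite uw.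
by apply: tends_to_oneM => //; exact: tends_to_oneV.
Qed.

End HarmonicClass.

Theorem lemma7 (R : realType) (d : nat) (hd : (3 <= d.+1)%N)
    (M : manifold R d) (hM : connected [set: mpoint M])
    (hS0 : boundary M !=set0) (hS : compact (boundary M))
    (g : tensor2 M) (Phi : chart R d M) (hg : asymptotically_flat g Phi)
    (g' : tensor2 M) (hg' : harmonic_class Phi g g') :
  forall A : R, 0 < A -> mu Phi g' A = mu Phi g A.
Proof.
move=> A _; case: hg => rg _ _ _ _; case: hg' => u [su u0 hu u1] <-.
(* Both suprema use the same chart [Phi], so equal classes give equal sets; [hd] is [2 <= d] by
   conversion. *)
by rewrite /mu harmonic_class_conformal.
Qed.
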